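(* Let $M$ be a Riemannian manifold, let $\phi$ be a flow on $M$ with $C^1$ velocity field $X$, and let $\Lambda\subset M$ be a compact $\phi$-invariant subset. Put $M^*=M\setminus\operatorname{fix}(\phi)$ and $\Lambda^*=\Lambda\setminus\operatorname{fix}(\phi)$, and assume that $M^*$ is connected. If $d_\sigma X$ is invertible for all $\sigma\in\operatorname{fix}(\phi)$ and $\phi|_{\Lambda^*}$ is BW-expansive with respect to $\operatorname{dist}_r$, then $\phi|_\Lambda$ is rescaling expansive.
   Context: $\operatorname{fix}(\phi)=\{\sigma:\phi_t(\sigma)=\sigma\ \forall t\in\mathbb{R}\}$. $\langle\cdot,\cdot\rangle$ is the Riemannian metric of $M$, $\|\cdot\|$ its norm and $\operatorname{dist}$ its distance. For $\sigma\in\operatorname{fix}(\phi)$, $d_\sigma X\colon T_\sigma M\to T_\sigma M$ is the derivative of $X$ at its zero $\sigma$. $\phi_I(x)=\{\phi_t(x):t\in I\}$ for $I\subset\mathbb{R}$. $\mathcal{H}^+_0(\mathbb{R})$ is the set of increasing homeomorphisms $h\colon\mathbb{R}\to\mathbb{R}$ with $h(0)=0$. The rescaled Riemannian metric on $M^*$ is $\langle v,w\rangle_r=\dfrac{\langle v,w\rangle}{\langle X(p),X(p)\rangle}$ for $v,w\in T_pM$, $p\in M^*$; $\operatorname{dist}_r$ denotes the distance on $M^*$ induced by $\langle\cdot,\cdot\rangle_r$ (infimum of lengths of curves in $M^*$). A flow $\phi$ on a metric space $(N,\rho)$ is BW-expansive (with respect to $\rho$) if for all $\varepsilon>0$ there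 is $\delta>0$ such that if $x,y\in N$, $h\in\mathcal{H}^+_0(\mathbb{R})$ and $\rho(\phi_t(x),\phi_{h(t)}(y))<\delta$ for all $t\in\mathbb{R}$, then $\phi_{h(t)}(y)\in\phi_{[-\varepsilon,\varepsilon]}(\phi_t(x))$ for all $t\in\mathbb{R}$. Here it is applied with $N=\Lambda^*$ and $\rho=\operatorname{dist}_r$. $\phi|_\Lambda$ is rescaling expansive if for all $\varepsilon>0$ there is $\delta>0$ such that if $x,y\in\Lambda$, $h\in\mathcal{H}^+_0(\mathbb{R})$ and $\operatorname{dist}(\phi_t(x),\phi_{h(t)}(y))\le\delta\|X(\phi_t(x))\|$ for all $t\in\mathbb{R}$, then $\phi_{h(t)}(y)\in\phi_{[-\varepsilon,\varepsilon]}(\phi_t(x))$ for all $t\in\mathbb{R}$. *)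

(* Defs.v *)
From HB Require Import structures.
From mathcomp Require Import all_boot all_order all_algebra.
From mathcomp Require Import all_classical all_reals all_analysis.

Set Implicit Arguments.
Unset Strict Implicit.
Unset Printing Implicit Defensive.
Import Order.TTheory GRing.Theory Num.Theory.
Import numFieldNormedType.Exports.
Local Open Scope classical_set_scope.
Local Open Scope ring_scope.

(* f is C^k on the open set U when it is continuous (k = 0), resp. when it is
   differentiable on U and x |-> df_x(v) is C^(k-1) for every v; since 'rV_n is
   finite-dimensional, the latter says that x |-> df_x is C^(k-1). *)
Fixpoint Ck (R : realType) (n : nat) (W : normedModType R) (k : nat)
    (U : set 'rV[R]_n) (f : 'rV[R]_n -> W) : Prop :=
  if k is k'.+1 then
    (forall x, U x -> differentiable f x) /\ forall v, Ck k' U ('D_v f)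
  else forall x, U x -> {for x, continuous f}.

Definition Coo (R : realType) (n : nat) (W : normedModType R)
    (U : set 'rV[R]_n) (f : 'rV[R]_n -> W) : Prop :=
  forall k, Ck k U f.

(* [coord] and [param] are total functions; only their values on [dom] and on
   [coord @` dom] are meaningful, where they are mutually inverse. *)
Record chart (R : realType) (n : nat) (M : topologicalType) := Chart {
  dom : set M;
  coord : M -> 'rV[R]_n;
  param : 'rV[R]_n -> M;
  open_dom : open dom;
  open_cod : open (coord @` dom);
  coordK : forall p, dom p -> param (coord p) = p;
  coord_continuous : forall p, dom p -> {for p, continuous coord};
  param_continuous : forall u, (coord @` dom) u -> {for u, continuous param}
}.

(* Smooth manifolds of dimension n, without boundary. [chart_at p] is a
   preferred chart around p. Throughout, the tangent space T_pM is identified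
   with 'rV_n by means of the coordinates of [chart_at p]; so a vector field is
   a function M -> 'rV_n, and a field of bilinear forms is a function
   M -> 'rV_n -> 'rV_n -> R. *)
Record manifold (R : realType) (n : nat) := Manifold {
  carrier :> topologicalType;
  manifold_hausdorff : hausdorff_space carrier;
  manifold_second_countable : @second_countable carrier;
  chart_index : Type;
  charts : chart_index -> chart R n carrier;
  chart_at : carrier -> chart_index;
  dom_chart_at : forall p, dom (charts (chart_at p)) p;
  smooth_transition : forall i j,
    Coo (coord (charts i) @` (dom (charts i) `&` dom (charts j)))
        (coord (charts j) \o param (charts i))
}.

Section Manifold.
Context {R : realType} {n : nat} {M : manifold R n}.
Implicit Types (i j : chart_index M) (p : M) (u v w : 'rV[R]_n).

Definition chart_cod i : set 'rV[R]_n := coord (charts i) @` dom (charts i).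

(* The components in chart j of the tangent vector at p whose components in
   chart i are v (for p in both domains). *)
Definition change_chart i j p v : 'rV[R]_n :=
  'd (coord (charts j) \o param (charts i)) (coord (charts i) p) v.

Definition field_in_chart (X : M -> 'rV[R]_n) i u : 'rV[R]_n :=
  let p := param (charts i) u in change_chart (chart_at p) i p (X p).

Definition form_in_chart (g : M -> 'rV[R]_n -> 'rV[R]_n -> R) i v w u : R :=
  let p := param (charts i) u in
  g p (change_chart i (chart_at p) p v) (change_chart i (chart_at p) p w).

Definition C1_field (X : M -> 'rV[R]_n) : Prop :=
  forall i, Ck 1 (chart_cod i) (field_in_chart X i).

(* d_pX : T_pM -> T_pM, meaningful at a zero p of X. *)
Definition field_deriv (X : M -> 'rV[R]_n) p : 'rV[R]_n -> 'rV[R]_n :=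
  'd (field_in_chart X (chart_at p)) (coord (charts (chart_at p)) p).

Definition velocity (c : R -> M) (t : R) : 'rV[R]_n :=
  derive1 (coord (charts (chart_at (c t))) \o c) t.

Definition C1_curve_on (A : set R) (c : R -> M) : Prop :=
  forall t, A t -> {for t, continuous c} /\
    forall i, dom (charts i) (c t) ->
      derivable (coord (charts i) \o c) t 1 /\
      {for t, continuous (derive1 (coord (charts i) \o c))}.

(* C^1 on a closed interval: extends to a C^1 curve on a larger open one. *)
Definition C1_arc (a b : R) (c : R -> M) : Prop :=
  exists c' : R -> M, exists2 e : R, 0 < e &
    C1_curve_on `]a - e, b + e[ c' /\ forall t, t \in `[a, b] -> c t = c' t.

Definition piecewise_C1 (c : R -> M) : Prop :=
  {within `[0, 1], continuous c} /\
  exists (N : nat) (tau : nat -> R), [/\ tau 0%N = 0, tau N = 1 &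
    forall k, (k < N)%N ->
      tau k < tau k.+1 /\ C1_arc (tau k) (tau k.+1) c].

(* [velocity c] takes arbitrary values at the finitely many break points. *)
Definition curve_length (g : M -> 'rV[R]_n -> 'rV[R]_n -> R) (c : R -> M)
    : \bar R :=
  (\int[lebesgue_measure]_(t in `[0%R, 1%R])
     (Num.sqrt (g (c t) (velocity c t) (velocity c t)))%:E)%E.

(* The distance on S induced by g, with value +oo between points of S that no
   curve in S joins. *)
Definition induced_dist (S : set M) (g : M -> 'rV[R]_n -> 'rV[R]_n -> R)
    (x y : M) : \bar R :=
  ereal_inf [set curve_length g c | c in
    [set c : R -> M | [/\ piecewise_C1 c, c 0 = x, c 1 = y &
                          forall t, t \in `[0, 1] -> S (c t)]]].

End Manifold.

Record riemannian_manifold (R : realType) (n : nat) := RiemannianManifold {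
  underlying :> manifold R n;
  metric : underlying -> 'rV[R]_n -> 'rV[R]_n -> R;
  metric_linear : forall p a u v w,
    metric p (a *: u + v) w = a * metric p u w + metric p v w;
  metric_sym : forall p v w, metric p v w = metric p w v;
  metric_pos : forall p v, v != 0 -> 0 < metric p v v;
  metric_smooth : forall (i : chart_index underlying) v w,
    Coo (chart_cod i) (form_in_chart metric i v w)
}.

Section Riemannian.
Context {R : realType} {n : nat} {M : riemannian_manifold R n}.

Definition tnorm (p : M) (v : 'rV[R]_n) : R := Num.sqrt (metric p v v).

Definition dist : M -> M -> \bar R := induced_dist [set: M] (@metric R n M).

Definition rescaled_metric (X : M -> 'rV[R]_n) (p : M) (v w : 'rV[R]_n) : R :=
  metric p v w / metric p (X p) (X p).

End Riemannian.

Definition is_flow (R : realType) (T : topologicalType) (phi : R -> T -> T)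
    : Prop :=
  [/\ continuous (fun z : R * T => phi z.1 z.2),
      forall x, phi 0 x = x &
      forall s t x, phi (s + t) x = phi s (phi t x)].

Definition fix_set (R : realType) (T : Type) (phi : R -> T -> T) : set T :=
  [set x | forall t, phi t x = x].

Definition orbit_arc (R : realType) (T : Type) (phi : R -> T -> T)
    (J : set R) (x : T) : set T :=
  [set phi t x | t in J].

Definition velocity_field (R : realType) (n : nat) (M : manifold R n)
    (phi : R -> M -> M) (X : M -> 'rV[R]_n) : Prop :=
  forall x, is_derive (0 : R) 1
    (fun t => coord (charts (chart_at x)) (phi t x)) (X x).

Definition dist_r (R : realType) (n : nat) (M : riemannian_manifold R n)
    (phi : R -> M -> M) (X : M -> 'rV[R]_n) : M -> M -> \bar R :=
  induced_dist (~` fix_set phi) (rescaled_metric X).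

Definition increasing_homeo0 (R : realType) (h : R -> R) : Prop :=
  [/\ {homo h : s t / s < t}, continuous h,
      exists k : R -> R, [/\ cancel h k, cancel k h & continuous k] &
      h 0 = 0].

Definition BW_expansive (R : realType) (T : Type) (N : set T)
    (rho : T -> T -> \bar R) (phi : R -> T -> T) : Prop :=
  forall e : R, 0 < e -> exists2 d : R, 0 < d &
    forall (x y : T) (h : R -> R), N x -> N y -> increasing_homeo0 h ->
      (forall t, (rho (phi t x) (phi (h t) y) < d%:E)%E) ->
      forall t, orbit_arc phi `[- e, e] (phi t x) (phi (h t) y).

Definition rescaling_expansive (R : realType) (n : nat)
    (M : riemannian_manifold R n) (L : set M) (phi : R -> M -> M)
    (X : M -> 'rV[R]_n) : Prop :=
  forall e : R, 0 < e -> exists2 d : R, 0 < d &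
    forall (x y : M) (h : R -> R), L x -> L y -> increasing_homeo0 h ->
      (forall t, (dist (phi t x) (phi (h t) y)
                  <= (d * tnorm (phi t x) (X (phi t x)))%:E)%E) ->
      forall t, orbit_arc phi `[- e, e] (phi t x) (phi (h t) y).

(* Main.v *)
(** If [X (phi t x) <> 0], a curve from [phi t x] to [phi (h t) y] whose length
    is at most [2 * d * |X (phi t x)|] stays in a chart, where the coordinates
    of [X] are Lipschitz and the metric is comparable with the coordinate norm.
    For small [d], [|X|] is therefore bounded below by a fixed fraction of
    [|X (phi t x)|] along this curve, so the curve avoids the fixed points and
    its rescaled length is small. The bounds are uniform by compactness of [L],
    and BW-expansiveness applies. If [X (phi t x) = 0], the hypothesis says that
    [phi t x] and [phi (h t) y] are at distance zero, hence equal. *)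

Require Import Defs.
From HB Require Import structures.
From mathcomp Require Import all_boot all_order all_algebra.
From mathcomp Require Import all_classical all_reals all_analysis.
From mathcomp Require Import measurable_realfun ring lra.
Import Order.TTheory GRing.Theory Num.Theory.
Import numFieldNormedType.Exports.
Import HBNNSimple.
Local Open Scope classical_set_scope.
Local Open Scope ring_scope.

Set Implicit Arguments.
Unset Strict Implicit.
Unset Printing Implicit Defensive.

(** * Calculus in coordinates *)

Lemma row_coord_le (R : realType) (n : nat) (v : 'rV[R]_n) (j : 'I_n) :
  `|v 0 j| <= `|v|.
Proof.
rewrite [leRHS]mx_normrE.
exact: (le_bigmax (0 : R) (fun ij : 'I_1 * 'I_n => `|v ij.1 ij.2|) (0, j)).
Qed.

Lemma row_norm_le (R : realType) (n : nat) (v : 'rV[R]_n) (k : R) :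
  0 <= k -> (forall j, `|v 0 j| <= k) -> `|v| <= k.
Proof.
move=> k0 vk; rewrite [leLHS]mx_normrE; apply: bigmax_le => // -[i j] _ /=.
by rewrite ord1.
Qed.

Lemma cvg_sum_fun (R : realType) (T : Type) (F : set_system T) {FF : Filter F}
    (I : finType) (f : I -> T -> R) (l : I -> R) :
  (forall i, f i x @[x --> F] --> l i) ->
  \sum_i f i x @[x --> F] --> \sum_i l i.
Proof. by move=> fl; apply: cvg_big => //; exact: add_continuous. Qed.

(** Expand [v] in the standard basis; the norm on rows is the maximum of the coordinates, so every
    coefficient is at most the norm of [v]. *)
Lemma diff_row_norm_le (R : realType) (n : nat) (W : normedModType R)
    (f : 'rV[R]_n -> W) (u v : 'rV[R]_n) :
  differentiable f u ->
  `|'d f u v| <= (\sum_j `|'D_('e_j) f u|) * `|v|.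
Proof.
move=> df; rewrite {1}(row_sum_delta v) linear_sum.
apply: le_trans (ler_norm_sum _ _ _) _.
rewrite mulr_suml; apply: ler_sum => j _.
rewrite linearZ /= normrZ mulrC deriveE//.
by apply: ler_wpM2l => //; exact: row_coord_le.
Qed.

Lemma is_derive_line (R : realType) (V W : normedModType R) (f : V -> W)
    (w v : V) (t : R) :
  differentiable f (w + t *: v) ->
  is_derive t 1 (fun s => f (w + s *: v)) ('d f (w + t *: v) v).
Proof.
move=> df.
have E : (fun h : R => h^-1 *: (((fun s => f (w + s *: v)) \o shift t) (h *: 1)
    - f (w + t *: v))) =
  (fun h => h^-1 *: ((f \o shift (w + t *: v)) (h *: v) - f (w + t *: v))).
  apply/funext => h /=; congr (_ *: (f _ - _)).
  by rewrite -[h *: 1]/(h * 1) mulr1 scalerDl addrCA.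
apply: DeriveDef; first by rewrite /derivable E; exact: diff_derivable.
by rewrite /derive E -deriveE.
Qed.

(** Mean value theorem for each coordinate of [f] along the segment from [w] to [u], which stays in
    the ball by convexity. There the differential is bounded, because the sum [S] of the norms of
    the partial derivatives is continuous at [u0]. *)
Lemma C1_near_lipschitz (R : realType) (n m : nat) (U : set 'rV[R]_n)
    (f : 'rV[R]_n -> 'rV[R]_m) (u0 : 'rV[R]_n) :
  open U -> U u0 -> Ck 1 U f ->
  exists K r : R, [/\ 0 < K, 0 < r &
    forall u w, `|u - u0| < r -> `|w - u0| < r -> `|f u - f w| <= K * `|u - w|].
Proof.
move=> oU Uu0 [df cf].
pose S u := \sum_j `|'D_('e_j) f u|.
have S0 u : 0 <= S u by apply: sumr_ge0.
have cS : S u @[u --> u0] --> S u0.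
  apply: (@cvg_sum_fun _ _ (nbhs u0)) => j.
  exact: (cvg_norm (cf 'e_j u0 Uu0)).
have : \forall u \near u0, U u /\ S u < S u0 + 1.
  near=> u; split; first by near: u; apply: open_nbhs_nbhs.
  near: u; apply: (cvgr_lt (S u0)) => //; by rewrite ltrDl.
move=> /nbhs_normP[r /= r0 /= rU].
exists (S u0 + 1), r; split => //; first by rewrite ltr_wpDl.
move=> u w ur wr.
have inB (t : R) : t \in `[0, 1] -> `|w + t *: (u - w) - u0| < r.
  rewrite in_itv/= => /andP[t0 t1].
  have -> : w + t *: (u - w) - u0 = (1 - t) *: (w - u0) + t *: (u - u0).
    rewrite scalerBl scale1r !scalerBr.
    rewrite [RHS]addrC opprB !addrA; apply/matrixP => i j; rewrite !mxE; ring.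
  apply: le_lt_trans (ler_normD _ _) _.
  rewrite !normrZ (ger0_norm t0) ger0_norm ?subr_ge0//.
  have [->|tn0] := eqVneq t 0; first by rewrite subr0 mul1r mul0r addr0.
  have tp : 0 < t by rewrite lt_def tn0.
  rewrite -[ltRHS](_ : (1 - t) * r + t * r = r); last by ring.
  apply: ler_ltD; last by rewrite ltr_pM2l.
  by apply: ler_wpM2l; rewrite ?subr_ge0// ltW.
apply: row_norm_le => [|k].
  by rewrite mulr_ge0// addr_ge0.
rewrite !mxE.
have dg (t : R) : t \in `[0, 1] ->
    is_derive t 1 (fun t => f (w + t *: (u - w)) 0 k)
      ('d f (w + t *: (u - w)) (u - w) 0 k).
  move=> t01; have /rU[Ut _] : `|u0 - (w + t *: (u - w))| < r.
    by rewrite distrC inB.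
  have := is_derive_line (df _ Ut) => -[dfl <-].
  apply: DeriveDef; first by move/derivable_mxP : dfl.
  by rewrite derive_mx// mxE.
have cg : {within `[0, 1], continuous (fun t => f (w + t *: (u - w)) 0 k)}.
  apply: derivable_within_continuous => t /dg[].
  by [].
have [t t01] := MVT_segment ler01 (fun t t01 => dg t (subset_itv_oo_cc t01)) cg.
rewrite scale1r scale0r addr0 subr0 mulr1 (addrC w) subrK => ->.
apply: le_trans (row_coord_le _ _) _.
have /rU[Ut St] : `|u0 - (w + t *: (u - w))| < r by rewrite distrC inB.
apply: le_trans (diff_row_norm_le _ _) _; first exact: df.
by apply: ler_wpM2r => //; exact: ltW.
Unshelve. all: by end_near. Qed.

(** * Lower bounds for integrals *)

(* [ge0_le_integral] asks for the measurability of both integrands. *)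
Lemma ge0_subset_le_integral d (T : measurableType d) (R : realType)
    (mu : {measure set T -> \bar R}) (D E : set T) (f g : T -> \bar R) :
  D `<=` E -> (forall x, D x -> (0 <= f x)%E) ->
  (forall x, E x -> (0 <= g x)%E) -> (forall x, D x -> (f x <= g x)%E) ->
  (\int[mu]_(x in D) f x <= \int[mu]_(x in E) g x)%E.
Proof.
move=> DE f0 g0 fg; rewrite !ge0_integralE//.
apply: ereal_sup_le => _ [h hf <-]; apply: imageP => x /=.
apply: le_trans (hf x) _; rewrite !patchE.
case: ifPn => [/set_mem xD|_].
  by rewrite mem_set; [exact: fg|exact: DE].
by have := erestrict_ge0 g0 x; rewrite patchE.
Qed.

(** By the fundamental theorem of calculus the increment of [w] is the integral of its derivative.
    The comparison with [s] is asked only inside the interval, because [s] will be the speed of a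
    curve that may have corners at [a] and [b]; [s] need not be measurable. *)
Lemma arc_increment_le (R : realType) (w s : R -> R) (a b K : R) :
  a <= b -> 0 <= K ->
  (forall t, t \in `[a, b] ->
    derivable w t 1 /\ {for t, continuous (derive1 w)}) ->
  (forall t, t \in `[a, b] -> 0 <= s t) ->
  (forall t, t \in `]a, b[ -> K * `|derive1 w t| <= s t) ->
  ((K * `|w b - w a|)%:E <=
     \int[lebesgue_measure]_(t in `[a, b]) (s t)%:E)%E.
Proof.
rewrite le_eqVlt => /predU1P[<-|ab] K0 dw s0 ws.
  by rewrite subrr normr0 mulr0 set_itv1 integral_set1.
pose f := derive1 w.
have cf : {within `[a, b], continuous f}.
  apply: continuous_in_subspaceT => t; rewrite inE/= => /dw[_].
  by [].
have cw : {in `[a, b], continuous w}.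
  move=> t /dw[dwt _]; apply: differentiable_continuous.
  exact/derivable1_diffP.
have FTC : (\int[lebesgue_measure]_(x in `[a, b]) (f x)%:E =
    (w b)%:E - (w a)%:E)%E.
  apply: continuous_FTC2 => //; split.
  - by move=> t tab; exact: (dw t (subset_itv_oo_cc tab)).1.
  - apply: cvg_at_right_filter; apply: cw; by rewrite in_itv/= lexx ltW.
  - apply: cvg_at_left_filter; apply: cw; by rewrite in_itv/= lexx ltW.
have mf : measurable_fun `[a, b] f.
  by apply: subspace_continuous_measurable_fun.
have -> : (K * `|w b - w a|)%:E =
    (K%:E * `|\int[lebesgue_measure]_(x in `[a, b]) (f x)%:E|)%E.
  by rewrite FTC.
apply: (@le_trans _ _
  (K%:E * \int[lebesgue_measure]_(x in `[a, b]) `|(f x)%:E|)%E).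
  apply: lee_wpmul2l; first by rewrite lee_fin.
  by apply: le_abse_integral => //; exact/measurable_EFinP.
have mnf : measurable_fun `[a, b] (fun t => `|(f t)%:E|%E).
  by apply: measurableT_comp => //; exact/measurable_EFinP.
rewrite -ge0_integralZl_EFin//.
have mKf := measurable_funeM K%:E mnf.
(* On the left the two endpoints are dropped as a null set, so that only the inequality in the open
   interval is used. *)
rewrite [leLHS]integral_itv_bndoo; last first.
  by apply: measurable_funS mKf => //; exact: subset_itv_oo_cc.
apply: ge0_subset_le_integral => [|t _|t tab|t tab].
- exact: subset_itv_oo_cc.
- by rewrite mule_ge0// lee_fin.
- by rewrite lee_fin; exact: s0.
- by rewrite lee_fin; exact: ws.
Qed.

(** * Bilinear forms *)

Section BilinearForms.
Context {R : realType} {n : nat}.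
Variable B : 'rV[R]_n -> 'rV[R]_n -> 'rV[R]_n -> R.
Hypothesis B_linear : forall u a v v' w,
  B (a *: v + v') w u = a * B v w u + B v' w u.
Hypothesis B_sym : forall u v w, B v w u = B w v u.

Lemma form0l u w : B 0 w u = 0.
Proof.
have := B_linear u 1 0 0 w; rewrite scale1r addr0 mul1r => h.
by apply: (@addrI _ (B 0 w u)); rewrite -h addr0.
Qed.

Lemma formZl u a v w : B (a *: v) w u = a * B v w u.
Proof. by rewrite -[a *: v]addr0 B_linear form0l addr0. Qed.

Lemma formDl u v v' w : B (v + v') w u = B v w u + B v' w u.
Proof. by rewrite -{1}[v]scale1r B_linear mul1r. Qed.

Lemma form_sqr_scale u a v : B (a *: v) (a *: v) u = a ^+ 2 * B v v u.
Proof. by rewrite formZl B_sym formZl mulrA. Qed.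

Lemma form_expand u v w :
  B v w u = \sum_j \sum_k v 0 j * w 0 k * B 'e_j 'e_k u.
Proof.
have sl v' w' : B v' w' u = \sum_j v' 0 j * B 'e_j w' u.
  rewrite {1}(row_sum_delta v').
  rewrite (big_morph (fun x => B x w' u) (fun x y => formDl u x y w')
    (form0l u w')).
  by apply: eq_bigr => j _; rewrite formZl.
rewrite sl; apply: eq_bigr => j _; rewrite B_sym sl mulr_sumr.
by apply: eq_bigr => k _; rewrite mulrA (B_sym _ 'e_k).
Qed.

Variable u0 : 'rV[R]_n.
Hypothesis B_continuous : forall v w, {for u0, continuous (B v w)}.

(** Continuity in the base point is assumed only for fixed vectors. Expanding in the basis leaves
    the finitely many entries [B 'e_j 'e_k], so the vector may vary together with the base point. *)
Lemma form_cvg {T : Type} {F : set_system T} {FF : Filter F}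
    (U V : T -> 'rV[R]_n) (v0 : 'rV[R]_n) :
  U x @[x --> F] --> u0 -> V x @[x --> F] --> v0 ->
  B (V x) (V x) (U x) @[x --> F] --> B v0 v0 u0.
Proof.
move=> cU cV; rewrite form_expand.
under eq_fun do rewrite form_expand.
have cVj j : V x 0 j @[x --> F] --> v0 0 j.
  exact: (cvg_comp _ _ cV (@coord_continuous R 1 n 0 j v0)).
apply: cvg_sum_fun => j; apply: cvg_sum_fun => k.
apply: cvgM; first by apply: cvgM.
exact: (cvg_comp _ _ cU (@B_continuous 'e_j 'e_k)).
Qed.

(** Compactness of the unit sphere makes the bounds on [B v v u] uniform in [v] for all [u] near
    [u0]; homogeneity extends them to all vectors. *)
Lemma form_equivalent_norm :
  (forall v, v != 0 -> 0 < B v v u0) ->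
  exists a b : R, [/\ 0 < a, 0 < b & \forall u \near u0, forall v,
    a * `|v| <= Num.sqrt (B v v u) <= b * `|v|].
Proof.
move=> Bpos.
pose S := [set v : 'rV[R]_n | `|v| = 1].
have cS : compact S.
  apply: bounded_closed_compact.
    by exists 1; split=> // x x1 v /= ->; exact: ltW.
  rewrite (_ : S = (fun v : 'rV[R]_n => `|v|) @^-1` [set 1])//.
  apply: preimage_closed; last exact: closed_eq.
  by move=> v _; exact: norm_continuous.
(* A single parameter [z.2], tending to 0 from the right, gives the lower bound, and its inverse the
   upper bound, so one covering argument yields both. *)
have : \forall z \near (nbhs u0, (0 : R)^'+),
    forall v, S v -> z.2 < B v v z.1 < z.2^-1.
  have /compact_near_coveringP cov := cS.
  apply: (cov _ (filter_prod (nbhs u0) ((0 : R)^'+))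
    (fun z v => z.2 < B v v z.1 < z.2^-1)) => v0 Sv0.
  have v00 : v0 != 0 by rewrite -normr_eq0 Sv0 oner_eq0.
  have b0 := Bpos _ v00; set b := B v0 v0 u0 in b0.
  have cB : (fun z : 'rV[R]_n * ('rV[R]_n * R) => B z.1 z.1 z.2.1)
     @ filter_prod (nbhs v0) (filter_prod (nbhs u0) ((0 : R)^'+)) --> b.
    apply: form_cvg.
      exact: (cvg_comp snd fst (@cvg_snd _ _ (nbhs v0) _ _)
        (@cvg_fst _ _ (nbhs u0) _ _)).
    exact: (@cvg_fst _ _ (nbhs v0)).
  (* Near [(v0, u0)] the form lies between [b / 2] and [b * 2]; it remains to take the parameter
     below [b / 2] and below [(b * 2)^-1]. *)
  have [b2 bb b2i] : [/\ b / 2 < b, b < b * 2 & 0 < b / 2] by split; lra.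
  have aP : \forall z \near
        filter_prod (nbhs v0) (filter_prod (nbhs u0) (0 : R)^'+),
      [/\ 0 < z.2.2, z.2.2 < b / 2 & z.2.2 < (b * 2)^-1].
    have cz : snd (snd z) @[z --> filter_prod (nbhs v0)
        (filter_prod (nbhs u0) (0 : R)^'+)] `=>` (0 : R)^'+.
      exact: (cvg_comp snd snd (@cvg_snd _ _ (nbhs v0) _ _)
        (@cvg_snd _ _ (nbhs u0) _ _)).
    apply: (cz [set a | [/\ 0 < a, a < b / 2 & a < (b * 2)^-1]]).
    near=> a; split; near: a.
    - exact: nbhs_right_gt.
    - exact: nbhs_right_lt.
    - by apply: nbhs_right_lt; rewrite invr_gt0 (lt_trans b0).
  have h : \forall z \near
        filter_prod (nbhs v0) (filter_prod (nbhs u0) (0 : R)^'+),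
      [/\ 0 < z.2.2, z.2.2 < b / 2 & z.2.2 < (b * 2)^-1] /\
      (b / 2 < B z.1 z.1 z.2.1 /\ B z.1 z.1 z.2.1 < b * 2).
    apply: filterI; first exact: aP.
    by apply: filterI; [exact: (cvgr_gt _ cB _ b2)|exact: (cvgr_lt _ cB _ bb)].
  apply: filterS h => -[v [u a]] /= [[a0 a1 a2] [h1 h2]].
  apply/andP; split; first exact: lt_trans h1.
  apply: lt_trans h2 _.
  by rewrite -[b * 2]invrK ltf_pV2// posrE// invr_gt0 (lt_trans b0).
move=> [[A1 A2] [/= nA1 nA2] sub].
have [a [A2a a0]] := filter_ex (filterI nA2 (nbhs_right_gt (0 : R))).
(* The form is quadratic in [v], so its square root scales like the norm. *)
exists (Num.sqrt a), (Num.sqrt a^-1).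
rewrite !sqrtr_gt0 invr_gt0 a0; split => //.
near=> u => v.
have [->|v0] := eqVneq v 0.
  by rewrite form0l normr0 !mulr0 sqrtr0 lexx.
have nv : 0 < `|v| by rewrite normr_gt0.
pose e := `|v|^-1 *: v.
have -> : B v v u = `|v| ^+ 2 * B e e u.
  by rewrite -form_sqr_scale /e scalerA divff ?gt_eqF// scale1r.
have Se : S e by rewrite /S/= /e normrZ normfV normr_id mulVf ?gt_eqF.
have /andP[l1 l2] : a < B e e u < a^-1.
  apply: (sub (u, a)) => //; split => //=.
  by near: u.
rewrite sqrtrM ?sqr_ge0// sqrtr_sqr normr_id ![_ * `|v|]mulrC !ler_pM2l//.
by rewrite !ler_wsqrtr// ltW.
Unshelve. all: by end_near. Qed.

End BilinearForms.

(** * Charts *)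

Lemma diff_near_eq (R : realType) (V W : normedModType R) (f g : V -> W)
    (a v : V) :
  differentiable f a -> differentiable g a -> (\near a, f a = g a) ->
  'd f a v = 'd g a v.
Proof.
by move=> df dg fg; rewrite -!deriveE//; exact: near_eq_derive.
Qed.

Section Charts.
Context {R : realType} {n : nat} {M : manifold R n}.
Implicit Types (i j k : chart_index M) (p : M) (u v w : 'rV[R]_n).

Local Notation D i := (dom (charts i)).
Local Notation crd i := (Defs.coord (charts i)).
Local Notation prm i := (param (charts i)).

Lemma chart_codK i u : chart_cod i u -> D i (prm i u) /\ crd i (prm i u) = u.
Proof. by move=> [p Dp <-]; rewrite coordK. Qed.

Lemma chart_cod_coord i p : D i p -> chart_cod i (crd i p).
Proof. by move=> Dp; exists p. Qed.

Lemma nbhs_dom i p : D i p -> nbhs p (D i).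
Proof. by move=> Dp; apply: open_nbhs_nbhs; split => //; exact: open_dom. Qed.

Lemma param_near_dom i j p : D i p -> D j p ->
  \forall u \near crd i p, D j (prm i u).
Proof.
move=> Dip Djp.
have := param_continuous (chart_cod_coord Dip).
rewrite /prop_for /continuous_at coordK// => /(_ _ (nbhs_dom Djp)); exact.
Qed.

Lemma chart_cod_near i u : chart_cod i u -> nbhs u (chart_cod i).
Proof. by move=> Du; apply: open_nbhs_nbhs; split => //; exact: open_cod. Qed.

Lemma differentiable_transition i j p : D i p -> D j p ->
  differentiable (crd j \o prm i) (crd i p).
Proof.
by move=> Dip Djp; have [+ _] := smooth_transition i j 1; apply; exists p.
Qed.

(** Chain rule. The composite of the two transition maps agrees with the direct one only near
    [crd i p], which is enough to determine the differential. *)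
Lemma change_chart_comp i j k p v : D i p -> D j p -> D k p ->
  change_chart j k p (change_chart i j p v) = change_chart i k p v.
Proof.
move=> Dip Djp Dkp; rewrite /change_chart.
have dij := differentiable_transition Dip Djp.
have djk := differentiable_transition Djp Dkp.
have dik := differentiable_transition Dip Dkp.
have E : (crd j \o prm i) (crd i p) = crd j p by rewrite /= coordK.
have djk' : differentiable (crd k \o prm j) ((crd j \o prm i) (crd i p)).
  by rewrite E.
transitivity ('d ((crd k \o prm j) \o (crd j \o prm i)) (crd i p) v).
  move: (congr1 (@^~ v) (diff_comp dij djk')); rewrite E => DC.
  by symmetry; exact: DC.
apply: diff_near_eq; [exact: differentiable_comp|exact: dik|].
near=> u => /=; rewrite coordK//.
near: u; exact: param_near_dom.
Unshelve. all: by end_near. Qed.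

Lemma change_chart_id i p v : D i p -> change_chart i i p v = v.
Proof.
move=> Dp; rewrite /change_chart.
rewrite (@diff_near_eq _ _ _ _ id) //; first by rewrite diff_val.
  exact: differentiable_transition.
near=> u => /=; apply: (chart_codK _).2.
near: u; apply: chart_cod_near; exact: chart_cod_coord.
Unshelve. all: by end_near. Qed.

Lemma change_chartK i j p v : D i p -> D j p ->
  change_chart j i p (change_chart i j p v) = v.
Proof. by move=> Di Dj; rewrite change_chart_comp// change_chart_id. Qed.

Lemma curve_near_dom i (c : R -> M) (t : R) :
  {for t, continuous c} -> D i (c t) -> \forall s \near t, D i (c s).
Proof. by move=> ct Dt; apply: ct; exact: nbhs_dom. Qed.

Lemma derive1_change_chart i j (c : R -> M) (t : R) :
  {for t, continuous c} -> D i (c t) -> D j (c t) ->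
  derivable (crd i \o c) t 1 ->
  derive1 (crd j \o c) t = change_chart i j (c t) (derive1 (crd i \o c) t).
Proof.
move=> ct Di Dj /derivable1_diffP di.
have dij := differentiable_transition Di Dj.
rewrite derive1E (near_eq_derive (g := (crd j \o prm i) \o (crd i \o c))).
  rewrite deriveE; last exact: differentiable_comp.
  by rewrite diff_comp// derive1E' .
near=> s => /=; rewrite coordK//; near: s; exact: curve_near_dom.
Unshelve. all: by end_near. Qed.

(** The chart used by [velocity] may change with [t]; this passes to one fixed chart, where
    continuity can be studied. *)
Lemma velocity_in_chart i (c : R -> M) (t : R) :
  {for t, continuous c} -> D i (c t) -> derivable (crd i \o c) t 1 ->
  velocity c t =
    change_chart i (chart_at (c t)) (c t) (derive1 (crd i \o c) t).
Proof.
by move=> ct Di di; apply: derive1_change_chart => //; exact: dom_chart_at.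
Qed.

End Charts.

(** * Speed and length of curves *)

Section Speed.
Context {R : realType} {n : nat} {M : riemannian_manifold R n}.
Implicit Types (i j : chart_index M) (p : M) (u v w : 'rV[R]_n) (c : R -> M).

Local Notation D i := (dom (charts i)).
Local Notation crd i := (Defs.coord (charts i)).
Local Notation form i := (form_in_chart (@metric R n M) i).

Lemma form_in_chart_linear i u (a : R) v v' w :
  form i (a *: v + v') w u = a * form i v w u + form i v' w u.
Proof. by rewrite /form_in_chart /change_chart linearP metric_linear. Qed.

Lemma form_in_chart_sym i u v w : form i v w u = form i w v u.
Proof. by rewrite /form_in_chart Defs.metric_sym. Qed.

Lemma form_in_chart_continuous i u v w : chart_cod i u ->
  {for u, continuous (form i v w)}.
Proof. by move=> Du; exact: (metric_smooth i v w 0). Qed.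

Lemma form_in_chart_gt0 i u v : chart_cod i u -> v != 0 -> 0 < form i v v u.
Proof.
move=> /chart_codK[Dp _] v0; apply: metric_pos; apply: contra v0 => /eqP v0.
rewrite -(change_chartK v Dp (dom_chart_at _)) v0 /change_chart.
by apply/eqP; exact: linear0.
Qed.

Lemma chart_norm_bounds i u0 : chart_cod i u0 ->
  exists a b : R, [/\ 0 < a, 0 < b & \forall u \near u0, forall v,
    a * `|v| <= Num.sqrt (form i v v u) <= b * `|v|].
Proof.
move=> Du0; apply: form_equivalent_norm.
- exact: form_in_chart_linear.
- exact: form_in_chart_sym.
- by move=> v w; exact: form_in_chart_continuous.
- by move=> v; exact: form_in_chart_gt0.
Qed.

Lemma tnorm_field_in_chart (X : M -> 'rV[R]_n) i p : D i p ->
  tnorm p (X p) = Num.sqrt (form i (field_in_chart X i (crd i p))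
    (field_in_chart X i (crd i p)) (crd i p)).
Proof.
move=> Dp; rewrite /form_in_chart /field_in_chart coordK//.
by rewrite !change_chartK//; exact: dom_chart_at.
Qed.

Definition speed c (t : R) : R := tnorm (c t) (velocity c t).

Lemma speed_in_chart i c (t : R) :
  {for t, continuous c} -> D i (c t) -> derivable (crd i \o c) t 1 ->
  speed c t = Num.sqrt (form i (derive1 (crd i \o c) t)
    (derive1 (crd i \o c) t) (crd i (c t))).
Proof.
move=> ct Dt dt; rewrite /speed /tnorm (velocity_in_chart ct Dt dt).
by rewrite /form_in_chart coordK.
Qed.

Lemma speed_ge0 c t : 0 <= speed c t.
Proof. exact: sqrtr_ge0. Qed.

Lemma C1_curve_on_eq (A : set R) c c' :
  open A -> (forall t, A t -> c t = c' t) ->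
  C1_curve_on A c' -> C1_curve_on A c.
Proof.
move=> oA cc' C1c' t At; have [ct c'i] := C1c' t At.
have Anbh : \forall s \near t, A s by apply: open_nbhs_nbhs.
have nc : \forall s \near t, c' s = c s.
  by apply: filterS Anbh => s /cc'.
split=> [|i].
  rewrite /prop_for /continuous_at cc'//.
  exact: cvg_trans (near_eq_cvg nc) ct.
rewrite cc'// => /c'i[di ci].
have nci : \forall s \near t, (crd i \o c') s = (crd i \o c) s.
  by apply: filterS nc => s /= ->.
have E s : A s -> derive1 (crd i \o c') s = derive1 (crd i \o c) s.
  move=> As; rewrite !derive1E; apply: near_eq_derive.
  have : nbhs s A by apply: open_nbhs_nbhs.
  by apply: filterS => r /cc' /= ->.
split; first exact: near_eq_derivable di.
rewrite /prop_for /continuous_at -(E t At).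
apply: cvg_trans ci; apply: near_eq_cvg.
by apply: filterS Anbh => s /E.
Qed.

(** The extension agrees with [c] only on the closed interval, so at its endpoints [c] itself may
    have a corner. *)
Lemma C1_arc_interior (a b : R) c : C1_arc a b c -> C1_curve_on `]a, b[ c.
Proof.
move=> [c' [e e0 [C1c' cc']]].
apply: (@C1_curve_on_eq _ _ c').
- exact: interval_open.
- by move=> t /subset_itv_oo_cc/cc'.
- move=> t tab; apply: C1c'; move: tab => /=; rewrite !in_itv/= => /andP[? ?].
  by apply/andP; split; lra.
Qed.

(** The velocity need not be continuous as a row, since the preferred chart may jump along [c]. The
    speed is: near [t] it is the square root of the form in the single chart at [c t]. *)
Lemma speed_continuous (A : set R) c (t : R) :
  open A -> C1_curve_on A c -> A t -> {for t, continuous (speed c)}.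
Proof.
move=> oA C1c At; have [ct ci] := C1c t At.
pose i := chart_at (c t).
have Dt : D i (c t) by exact: dom_chart_at.
have [di cdi] := ci i Dt.
have Du := chart_cod_coord Dt.
rewrite /prop_for /continuous_at (speed_in_chart ct Dt di).
have near_form : \forall s \near t, Num.sqrt (form i (derive1 (crd i \o c) s)
    (derive1 (crd i \o c) s) (crd i (c s))) = speed c s.
  have nD := curve_near_dom ct Dt.
  have nA : \forall s \near t, A s by apply: open_nbhs_nbhs.
  near=> s.
  have As : A s by near: s.
  have Ds : D i (c s) by near: s.
  have [cs /(_ _ Ds)[ds _]] := C1c s As.
  by rewrite (speed_in_chart cs Ds ds).
apply: cvg_trans (near_eq_cvg near_form) _.
have cform : form i (derive1 (crd i \o c) s) (derive1 (crd i \o c) s)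
    (crd i (c s)) @[s --> t] --> form i (derive1 (crd i \o c) t)
    (derive1 (crd i \o c) t) (crd i (c t)).
  apply: (@form_cvg _ _ (form i) (@form_in_chart_linear i)
    (@form_in_chart_sym i)) => //.
    by move=> v w; exact: form_in_chart_continuous.
  exact: (cvg_comp _ _ ct (Defs.coord_continuous Dt)).
exact: (cvg_comp _ _ cform (@sqrt_continuous R _)).
Unshelve. all: by end_near. Qed.

Lemma speed_measurable_arc (a b : R) c : C1_arc a b c ->
  measurable_fun `[a, b] (speed c).
Proof.
move=> /C1_arc_interior C1c; apply: (@measurable_fun_itv_cc _ _ _ false true).
apply: open_continuous_measurable_fun; first exact: interval_open.
move=> t; rewrite inE/= => tab.
exact: (@speed_continuous `]a, b[%classic _ _ (@interval_open _ _ _ _ _ )).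
Qed.

End Speed.

(** * Length bounds the displacement in coordinates *)

Section CurveLength.
Context {R : realType} {n : nat} {M : riemannian_manifold R n}.
Implicit Types (i j : chart_index M) (p : M) (u v w : 'rV[R]_n) (c : R -> M).

Local Notation D i := (dom (charts i)).
Local Notation crd i := (Defs.coord (charts i)).
Local Notation form i := (form_in_chart (@metric R n M) i).
Local Notation mu := (@lebesgue_measure R).

Lemma itv_cc_setU (a b e : R) : a <= b -> b <= e ->
  `[a, e]%classic = `[a, b]%classic `|` `]b, e]%classic.
Proof.
move=> ab be; apply/seteqP; split=> t /=; rewrite !in_itv/=.
  move=> /andP[at_ te]; have [tb|bt] := leP t b; [left|right].
    by rewrite at_.
  by rewrite te.
case=> /andP[h1 h2]; apply/andP; split=> //; first exact: le_trans be.
by rewrite (le_trans ab)// ltW.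
Qed.

Lemma breakpoint_ge0 (N : nat) (tau : nat -> R) : tau 0%N = 0 ->
  (forall k, (k < N)%N -> tau k < tau k.+1) ->
  forall k, (k <= N)%N -> 0 <= tau k.
Proof.
move=> tau0 tault; elim=> [|k IH] kN; first by rewrite tau0.
by rewrite (le_trans (IH (ltnW kN)))// ltW// tault.
Qed.

(** Induction on the break points, adding one half-open arc at a time. *)
Lemma speed_measurable c :
  piecewise_C1 c -> measurable_fun `[0 : R, 1 : R] (speed c).
Proof.
move=> [_ [N [tau [tau0 tau1 arcs]]]].
have tault k : (k < N)%N -> tau k < tau k.+1 by move=> /arcs[].
have tauge0 := breakpoint_ge0 tau0 tault.
suff H k : (k <= N)%N -> measurable_fun `[0 : R, tau k] (speed c).
  by rewrite -tau1; exact: H.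
elim: k => [_|k IH kN].
  by rewrite tau0 set_itv1; exact: measurable_fun_set1.
have [tk arck] := arcs _ kN.
rewrite (itv_cc_setU (tauge0 _ (ltnW kN)) (ltW tk)).
apply/measurable_funU => //; split; first exact: IH (ltnW kN).
apply: measurable_funS (speed_measurable_arc arck) => //.
exact: subset_itv_oc_cc.
Qed.

Lemma curve_length_speed c :
  curve_length (@metric R n M) c =
  (\int[mu]_(t in `[0%R, 1%R]) (speed c t)%:E)%E.
Proof. by []. Qed.

Definition form_ge_at i (K : R) p :=
  D i p /\ forall v, K * `|v| <= Num.sqrt (form i v v (crd i p)).

Lemma derivable_row_coord (U : R -> 'rV[R]_n) (t : R) (j : 'I_n) :
  derivable U t 1 -> derivable (fun s => U s 0 j) t 1.
Proof. by move/derivable_mxP; apply. Qed.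

Lemma derive1_row_coord (U : R -> 'rV[R]_n) (t : R) (j : 'I_n) :
  derivable U t 1 -> derive1 (fun s => U s 0 j) t = derive1 U t 0 j.
Proof. by move=> dU; rewrite !derive1E derive_mx// mxE. Qed.

(** The coordinate is differentiated along the extension [c'], which is regular up to the endpoints,
    while the integrand is the speed of [c]; the two curves agree on the arc. The time [e] may stop
    before the end [b] of the arc. *)
Lemma arc_coord_increment_le c i (j : 'I_n) (K a b e : R) : 0 <= K ->
  a <= e -> e <= b -> C1_arc a b c ->
  (forall t, t \in `[a, e] -> form_ge_at i K (c t)) ->
  ((K * `|crd i (c e) 0 j - crd i (c a) 0 j|)%:E <=
    \int[mu]_(t in `[a, e]) (speed c t)%:E)%E.
Proof.
move=> K0 ae eb arc good.
have C1c := C1_arc_interior arc.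
have [c' [d d0 [C1c' cc']]] := arc.
have in_ab t : t \in `[a, e] -> t \in `[a, b].
  by rewrite !in_itv/= => /andP[-> te]; exact: le_trans eb.
have in_ab' t : t \in `]a, e[ -> t \in `]a, b[.
  by rewrite !in_itv/= => /andP[-> te]; exact: lt_le_trans eb.
have in_ext t : t \in `[a, b] -> `]a - d, b + d[%classic t.
  by rewrite /= !in_itv/= => /andP[? ?]; apply/andP; split; lra.
rewrite !cc' ?in_itv/= ?lexx ?(le_trans ae eb) ?ae ?eb//.
apply: (@arc_increment_le R (fun t => crd i (c' t) 0 j)) => //.
- move=> t tae; have [Dt _] := good _ tae.
  rewrite cc' in Dt; last exact: in_ab.
  have [ct /(_ _ Dt)[dt cdt]] := C1c' t (in_ext _ (in_ab _ tae)).
  split; first exact: derivable_row_coord dt.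
  have near_d : \forall s \near t, derive1 (crd i \o c') s 0 j =
      derive1 (fun s => crd i (c' s) 0 j) s.
    have nD := curve_near_dom ct Dt.
    have nA : \forall s \near t, `]a - d, b + d[%classic s.
      apply: open_nbhs_nbhs; split; first exact: interval_open.
      exact/in_ext/in_ab.
    near=> s.
    have As : `]a - d, b + d[%classic s by near: s.
    have Ds : D i (c' s) by near: s.
    have [_ /(_ _ Ds)[ds _]] := C1c' s As.
    by rewrite -(derive1_row_coord j ds).
  rewrite /prop_for /continuous_at (derive1_row_coord j dt).
  apply: cvg_trans (near_eq_cvg near_d) _.
  exact: (cvg_comp _ _ cdt (@coord_continuous R 1 n 0 j _)).
- move=> t _; exact: speed_ge0.
move=> t tae.
have tcc := subset_itv_oo_cc tae.
have [Dt bt] := good _ tcc.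
have [ct /(_ _ Dt)[dt cdt]] := C1c t (in_ab' _ tae).
rewrite (speed_in_chart ct Dt dt).
apply: le_trans (bt _); apply: ler_wpM2l => //.
have dt' : derive1 (fun s => crd i (c' s) 0 j) t = derive1 (crd i \o c) t 0 j.
  rewrite -(derive1_row_coord j dt) !derive1E; apply: near_eq_derive.
  have : \forall s \near t, s \in `]a, e[ by exact: near_in_itvoo.
  by apply: filterS => s /subset_itv_oo_cc/in_ab/cc' /= ->.
by rewrite dt'; exact: row_coord_le.
Unshelve. all: by end_near. Qed.

(** Add the increments over the successive arcs by the triangle inequality. Working with one
    coordinate at a time loses nothing, since the norm is a maximum. *)
Lemma coord_increment_le c i (K t : R) : piecewise_C1 c -> 0 <= K ->
  t \in `[0, 1] -> (forall s, s \in `[0, t] -> form_ge_at i K (c s)) ->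
  ((K * `|crd i (c t) - crd i (c 0)|)%:E <= curve_length (@metric R n M) c)%E.
Proof.
move=> pc K0; rewrite in_itv/= => /andP[t0 t1] good.
have ms := speed_measurable pc.
have [_ [N [tau [tau0 tau1 arcs]]]] := pc.
have tault k : (k < N)%N -> tau k < tau k.+1 by move=> /arcs[].
have tauge0 := breakpoint_ge0 tau0 tault.
apply: (@le_trans _ _ (\int[mu]_(t in `[0%R, t]) (speed c t)%:E)%E); last first.
  rewrite curve_length_speed; apply: ge0_subset_le_integral => //.
  - by move=> s /=; rewrite !in_itv/= => /andP[-> st]; exact: le_trans t1.
  - by move=> s _; rewrite lee_fin speed_ge0.
  - by move=> s _; rewrite lee_fin speed_ge0.
have msE : measurable_fun `[0 : R, 1 : R] (fun s => (speed c s)%:E).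
  exact/measurable_EFinP.
(* Intermediate times [e] are included because [t] need not be a break point. *)
suff H (j : 'I_n) k : (k <= N)%N -> forall e, 0 <= e -> e <= t -> e <= tau k ->
    ((K * `|crd i (c e) 0 j - crd i (c 0) 0 j|)%:E <=
      \int[mu]_(s in `[0%R, e]) (speed c s)%:E)%E.
  set u := crd i (c t) - crd i (c 0).
  (* A nonzero row attains its norm at some coordinate; a zero row may have no coordinate at all, as
     [n] can be 0. *)
  have [u0|u0] := eqVneq u 0.
    rewrite u0 normr0 mulr0; apply: integral_ge0 => s _.
    by rewrite lee_fin speed_ge0.
  have : mx_norm u != 0 by apply: contra u0 => /eqP/mx_norm_eq0 ->.
  move=> /mx_norm_neq0[[i0 j] /= uj]; rewrite ord1 in uj.
  rewrite (_ : `|u| = `|u 0 j|)// /u !mxE.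
  by apply: (H j N) => //; rewrite tau1.
elim: k => [_|k IH kN] e e0 et etau.
  rewrite tau0 in etau; have -> : e = 0 by apply/le_anti; rewrite etau.
  by rewrite subrr normr0 mulr0 set_itv1 integral_set1.
have [etk|tke] := leP e (tau k); first exact: IH (ltnW kN) _ _ _ _.
have tk0 := tauge0 _ (ltnW kN).
have {}IH := IH (ltnW kN) _ tk0 (le_trans (ltW tke) et) (lexx _).
have [_ arck] := arcs _ kN.
have sub01 (a b : R) b0 : 0 <= a -> b <= t ->
    [set` Interval (BSide b0 a) (BRight b)] `<=` `[0, 1]%classic.
  move=> a0 bt s /=; rewrite !in_itv/= => /andP[h1 h2]; apply/andP; split.
    by apply: le_trans a0 _; move: h1; case: b0 => //=; exact: ltW.
  by rewrite (le_trans h2)// (le_trans bt).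
have me := measurable_funS _ (sub01 _ _ _ _ _) msE.
have inc : ((K * `|crd i (c e) 0 j - crd i (c (tau k)) 0 j|)%:E <=
    \int[mu]_(t in `[tau k, e]) (speed c t)%:E)%E.
  apply: arc_coord_increment_le arck _ => //; first exact: ltW.
  move=> s; rewrite in_itv/= => /andP[h1 h2]; apply: good; rewrite in_itv/=.
  by rewrite (le_trans tk0)//= (le_trans h2).
rewrite (itv_cc_setU tk0 (ltW tke)) ge0_integral_setU//=; first last.
- apply/disj_setPS => s [/=]; rewrite !in_itv/= => /andP[_ h1] /andP[h2 _].
  by move: (lt_le_trans h2 h1); rewrite ltxx.
- by move=> s _; rewrite lee_fin speed_ge0.
- rewrite -(itv_cc_setU tk0 (ltW tke)); exact: me.
rewrite integral_itv_obnd_cbnd; last by apply: me; rewrite ?tk0.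
apply: le_trans (leeD IH inc); rewrite -EFinD lee_fin -mulrDr ler_wpM2l//.
apply: le_trans (ler_normD _ _).
by rewrite [X in _ <= `|X|]addrC subrKA.
Qed.

End CurveLength.

(** * Curves staying in a chart *)

Section Distance.
Context {R : realType} {n : nat} {M : riemannian_manifold R n}.
Implicit Types (i j : chart_index M) (p : M) (u v w : 'rV[R]_n) (c : R -> M).

Local Notation D i := (dom (charts i)).
Local Notation crd i := (Defs.coord (charts i)).
Local Notation prm i := (param (charts i)).
Local Notation form i := (form_in_chart (@metric R n M) i).
Local Notation len := (curve_length (@metric R n M)).

Definition form_ge_ball i (K : R) u0 (r : R) := forall u, `|u - u0| < r ->
  chart_cod i u /\ forall v, K * `|v| <= Num.sqrt (form i v v u).

Lemma curve_length_ge0 c : (0 <= len c)%E.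
Proof. by apply: integral_ge0 => t _; rewrite lee_fin sqrtr_ge0. Qed.

(** The set is the image under [param] of a compact ball contained in the range of the chart, hence
    compact, hence closed since [M] is Hausdorff. *)
Lemma closed_coord_ball i u0 (r s : R) : s < r ->
  (forall u, `|u - u0| < r -> chart_cod i u) ->
  closed [set p | D i p /\ `|crd i p - u0| <= s].
Proof.
move=> sr cod_ball; set A := (X in closed X).
have -> : A = prm i @` [set u | `|u - u0| <= s].
  apply/seteqP; split=> [p [Dp ps]|_ [u us <-]].
    by exists (crd i p) => //; exact: coordK.
  have /chart_codK[Du Eu] := cod_ball u (le_lt_trans us sr).
  by split=> //; rewrite Eu.
apply: compact_closed; first exact: manifold_hausdorff.
apply: continuous_compact.
  apply: continuous_in_subspaceT => u; rewrite inE/= => us.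
  by apply: param_continuous; apply: cod_ball; exact: le_lt_trans sr.
apply: bounded_closed_compact.
  exists (s + `|u0|); split=> [|y sy u /= us]; first exact: num_real.
  apply: ltW; apply: le_lt_trans sy.
  by rewrite -[u](subrK u0) (le_trans (ler_normD _ _))// lerD2r.
rewrite (_ : [set u | _] = (fun u => `|u - u0|) @^-1` [set t | t <= s])//.
apply: preimage_closed; last exact: closed_le.
move=> u _; apply: continuous_comp; last exact: norm_continuous.
by apply: continuousB; [exact: cvg_id|exact: cst_continuous].
Qed.

Lemma curve_in_chart c i (K r : R) : 0 < K -> 0 < r -> D i (c 0) ->
  form_ge_ball i K (crd i (c 0)) r -> piecewise_C1 c ->
  (len c < (K * r)%:E)%E ->
  forall t, t \in `[0, 1] ->
    D i (c t) /\ ((K * `|crd i (c t) - crd i (c 0)|)%:E <= len c)%E.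
Proof.
move=> K0 r0 D0 good pc lenc.
(* Up to its first exit from the ball of radius [r], the curve lies in the
   closed ball of radius [l / K < r], which is closed in [M]. *)
have lfin : len c \is a fin_num.
  by rewrite ge0_fin_numE ?curve_length_ge0// (lt_le_trans lenc)// leey.
pose l := fine (len c).
have lenE : len c = l%:E by rewrite /l fineK.
have l0 : 0 <= l by rewrite -lee_fin -lenE curve_length_ge0.
have lr : l / K < r by rewrite ltr_pdivrMr// mulrC -lte_fin -lenE.
pose O := [set p | D i p /\ `|crd i p - crd i (c 0)| < r].
have goodO p : O p -> form_ge_at i K p.
  by move=> [Dp pr]; split=> //; exact: (good _ pr).2.
pose A := [set p | D i p /\ `|crd i p - crd i (c 0)| <= l / K].
have AO : A `<=` O by move=> p [Dp pr]; split=> //; exact: le_lt_trans lr.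
have clA : closed A by apply: closed_coord_ball lr _ => u /good[].
have nO p : O p -> nbhs p O.
  move=> [Dp pr]; have cp := Defs.coord_continuous Dp.
  apply: filterI; first exact: nbhs_dom.
  have : (fun q => `|crd i q - crd i (c 0)|) @ p --> `|crd i p - crd i (c 0)|.
    by apply: cvg_norm; apply: cvgB => //; exact: cst_continuous.
  by move=> /(cvgr_lt _)/(_ _ pr).
(* As long as the curve has stayed in [O], the length bound puts it in the smaller closed set
   [A]. *)
have inA t : t \in `[0, 1] -> (forall s, s \in `[0, t] -> O (c s)) -> A (c t).
  move=> t01 Os; split.
    by apply: (Os t _).1; move: t01; rewrite !in_itv/= lexx andbT => /andP[].
  rewrite ler_pdivlMr// mulrC -lee_fin -lenE.
  by apply: coord_increment_le (ltW K0) t01 _ => // s /Os/goodO.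
suff H t : t \in `[0, 1] -> A (c t).
  move=> t /H[Dt tl]; split=> //; rewrite lenE lee_fin mulrC.
  by rewrite -ler_pdivlMr.
suff H s : s \in `[0, 1] -> O (c s).
  move=> t01; apply: inA => // s st; apply: H.
  move: t01 st; rewrite !in_itv/= => /andP[_ t1] /andP[-> st] /=.
  exact: le_trans t1.
move=> s01; apply: contrapT => Os.
pose B := [set t : R | t \in `[0, 1] /\ ~ O (c t)].
have Bs : B s by [].
have Blb : lbound B 0 by move=> b [+ _]; rewrite in_itv/= => /andP[].
have Binf : has_inf B by split; [exists s|exists 0].
(* [T] is the first exit time from [O]. *)
pose T := inf B.
have T0 : 0 <= T by apply: lb_le_inf => //; exists s.
have T1 : T <= 1.
  apply: le_trans (_ : s <= 1); last by move: s01; rewrite in_itv/= => /andP[].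
  by apply: ge_inf Bs; exists 0.
have T01 : T \in `[0, 1] by rewrite in_itv/= T0.
have before q : 0 <= q -> q < T -> O (c q).
  move=> t0 tT; apply: contrapT => Ot.
  suff : T <= q by rewrite leNgt tT.
  apply: ge_inf; first by exists 0.
  by split=> //; rewrite in_itv/= t0 (le_trans (ltW tT)).
have cT : forall V, nbhs (c T) V -> \forall t \near T, t \in `[0, 1] -> V (c t).
  move=> V nV; have [cc _] := pc.
  have /subspace_continuousP/(_ T T01) := cc; exact.
(* Either [T] is 0, or [c T] is a limit from the left of points of the closed set [A]. *)
have AT : A (c T).
  move: T0; rewrite le_eqVlt => /predU1P[T0|Tpos].
    by rewrite -T0; split=> //; rewrite subrr normr0 divr_ge0// ltW.
  apply: clA => V /cT nV.
  have : \forall q \near T^'-, [/\ 0 < q, q < T & q \in `[0, 1] -> V (c q)].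
    near=> q; split; near: q.
    - exact: nbhs_left_gt.
    - exact: nbhs_left_lt.
    - rewrite /at_left; apply: filterS nV => z Vz _; exact: Vz.
  move=> /filter_ex[q [q0 qT Vq]].
  have q01 : q \in `[0, 1] by rewrite in_itv/= (ltW q0) (le_trans (ltW qT)).
  exists (c q); split; last exact: Vq.
  apply: inA => // z; rewrite in_itv/= => /andP[z0 zq].
  by apply: before => //; exact: le_lt_trans qT.
(* Since [O] is open, the curve remains in it for a short time after [T], contradicting the choice
   of [T] as an infimum of exit times. *)
have /cT/nbhs_normP[e /= e0 eO] := nO _ (AO _ AT).
have [b Bb bT] := inf_adherent e0 Binf.
have Tb : T <= b by apply: ge_inf => //; exists 0.
apply: Bb.2; apply: eO Bb.1 => /=.
by rewrite distrC ger0_norm ?subr_ge0// ltrBlDl.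
Unshelve. all: by end_near. Qed.

Lemma form_ge_ball_exists i u0 : chart_cod i u0 ->
  exists K r : R, [/\ 0 < K, 0 < r & form_ge_ball i K u0 r].
Proof.
move=> Du0; have [a [b [a0 b0 ab]]] := chart_norm_bounds Du0.
have : \forall u \near u0, chart_cod i u /\
    forall v, a * `|v| <= Num.sqrt (form i v v u) <= b * `|v|.
  by apply: filterI ab; exact: chart_cod_near.
move=> /nbhs_normP[r /= r0 rU].
exists a, r; split=> // u ur.
have /rU[Du Hu] : `|u0 - u| < r by rewrite distrC.
by split=> // v; have /andP[] := Hu v.
Qed.

(** Curves from [p] to [q] of length below [K * s] exist for every small [s > 0], and they confine
    [q] to the coordinate ball of radius [s] around [p]. *)
Lemma dist_eq (p q : M) : (dist p q <= 0)%E -> p = q.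
Proof.
move=> pq; pose i := chart_at p.
have Dp : D i p by exact: dom_chart_at.
have [K [r [K0 r0 good]]] := form_ge_ball_exists (chart_cod_coord Dp).
have near_q (s : R) : 0 < s -> s <= r ->
    D i q /\ `|crd i q - crd i p| < s.
  move=> s0 sr.
  have : (dist p q < (K * s)%:E)%E.
    by rewrite (le_lt_trans pq)// lte_fin mulr_gt0.
  move=> /ereal_inf_lt[_ [c [pc c0 c1 _] <-] lc].
  have D0 : D i (c 0) by rewrite c0.
  have g0 : form_ge_ball i K (crd i (c 0)) s.
    by rewrite c0 => u us; apply: good; exact: lt_le_trans sr.
  have i1 : (1 : R) \in `[0, 1] by rewrite in_itv/= lexx ler01.
  have [Dq Hq] := curve_in_chart K0 s0 D0 g0 pc lc i1.
  rewrite c1 in Dq Hq; rewrite c0 in Hq; split=> //.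
  by have := le_lt_trans Hq lc; rewrite lte_fin ltr_pM2l.
have [Dq _] := near_q r r0 (lexx _).
suff E : crd i p = crd i q by rewrite -(coordK Dp) E coordK.
apply/eqP; rewrite eq_sym -subr_eq0 -normr_le0 leNgt; apply/negP => d0.
(* For this radius [near_q] would make the coordinate distance smaller than itself. *)
pose s := Num.min r `|crd i q - crd i p|.
have s0 : 0 < s by rewrite lt_min r0.
have sr : s <= r by rewrite ge_min lexx.
have [_] := near_q s s0 sr.
by rewrite lt_min ltxx andbF.
Qed.

End Distance.

(** * The rescaled distance *)

Section Rescaling.
Context {R : realType} {n : nat} {M : riemannian_manifold R n}.
Variables (phi : R -> M -> M) (X : M -> 'rV[R]_n).
Implicit Types (i j : chart_index M) (p : M) (u v w : 'rV[R]_n) (c : R -> M).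

Local Notation D i := (dom (charts i)).
Local Notation crd i := (Defs.coord (charts i)).
Local Notation form i := (form_in_chart (@metric R n M) i).
Local Notation len := (curve_length (@metric R n M)).
Local Notation mu := (@lebesgue_measure R).

Lemma metric0l p w : metric p 0 w = 0.
Proof.
have := metric_linear p 1 0 0 w; rewrite scale1r addr0 mul1r => h.
by apply: (@addrI _ (metric p 0 w)); rewrite -h addr0.
Qed.

Lemma tnorm_eq0 p v : (tnorm p v == 0) = (v == 0).
Proof.
have [->|v0] := eqVneq v 0; first by rewrite /tnorm metric0l sqrtr0 eqxx.
by rewrite gt_eqF// sqrtr_gt0 metric_pos.
Qed.

Lemma metric_ge0 p v : 0 <= metric p v v.
Proof.
have [->|v0] := eqVneq v 0; first by rewrite metric0l.
by rewrite ltW// metric_pos.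
Qed.

Lemma tnorm_ge0 p v : 0 <= tnorm p v.
Proof. exact: sqrtr_ge0. Qed.

Lemma velocity_field_fix p : velocity_field phi X -> fix_set phi p -> X p = 0.
Proof.
move=> /(_ p) + fp.
rewrite (_ : (fun t => _) = cst (crd (chart_at p) p)).
  by move=> [_ <-]; rewrite derive_cst.
by apply/funext => t /=; rewrite fp.
Qed.

Lemma piecewise_C1_cst p : piecewise_C1 (fun _ : R => p).
Proof.
split; first by move=> ?; exact: cst_continuous.
exists 1%N, (fun k => k%:R); split=> // -[|//] _; split; first exact: ltr01.
exists (fun=> p), 1 => //; split=> // t _; split; first exact: cst_continuous.
move=> i _; rewrite (_ : crd i \o _ = cst (crd i p))//.
split; first exact: derivable_cst.
rewrite (_ : derive1 _ = cst 0); first exact: cst_continuous.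
by apply/funext => s; rewrite derive1_cst.
Qed.

Lemma dist_r_refl p : ~ fix_set phi p -> (dist_r phi X p p <= 0)%E.
Proof.
move=> np; apply: ereal_inf_lbound; exists (fun=> p).
  by split=> //; exact: piecewise_C1_cst.
rewrite /curve_length integral0_eq// => t _.
rewrite /velocity (_ : _ \o _ = cst (crd (chart_at p) p))// derive1_cst.
by rewrite /rescaled_metric metric0l mul0r sqrtr0.
Qed.

(** The rescaled speed is the speed divided by the norm of [X], which is at least [m]. *)
Lemma rescaled_length_le c (m : R) : 0 < m -> piecewise_C1 c ->
  (forall t, t \in `[0, 1] -> m <= tnorm (c t) (X (c t))) ->
  (curve_length (rescaled_metric X) c <= (m^-1)%:E * len c)%E.
Proof.
move=> m0 pc mX.
rewrite [len c]curve_length_speed -ge0_integralZl_EFin//; first last.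
- by rewrite invr_ge0 ltW.
- by apply/measurable_EFinP; exact: speed_measurable.
- by move=> t _; rewrite lee_fin speed_ge0.
apply: ge0_subset_le_integral => // t t01; rewrite ?lee_fin ?sqrtr_ge0//.
  by rewrite mulr_ge0 ?invr_ge0 ?speed_ge0// ltW.
have := mX t t01; rewrite /tnorm => mt.
rewrite /rescaled_metric sqrtrM ?metric_ge0// sqrtrV ?metric_ge0// mulrC.
by rewrite ler_wpM2r ?sqrtr_ge0// lef_pV2// posrE// (lt_le_trans m0).
Qed.

(** Stated jointly for [x] near [x0] and [d] near 0, so that compactness of [L] can later provide
    one [d] for all its points. *)
Lemma short_curves_near (eta : R) (x0 : M) :
  C1_field X -> velocity_field phi X -> 0 < eta ->
  \forall x \near x0 & d \near 0^'+, forall y, X x != 0 ->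
    (dist x y <= (d * tnorm x (X x))%:E)%E ->
    ~ fix_set phi y /\ (dist_r phi X x y < eta%:E)%E.
Proof.
move=> XC1 Xvel eta0.
pose i := chart_at x0; pose u0 := crd i x0.
have Dx0 : D i x0 by exact: dom_chart_at.
have Du0 : chart_cod i u0 by exact: chart_cod_coord.
pose Y := field_in_chart X i.
have [K [r1 [K0 r10 lipY]]] :=
  C1_near_lipschitz (@open_cod _ _ _ (charts i)) Du0 (XC1 i).
have [a [b [a0 b0 ab]]] := chart_norm_bounds Du0.
have : \forall u \near u0, chart_cod i u /\
    forall v, a * `|v| <= Num.sqrt (form i v v u) <= b * `|v|.
  by apply: filterI ab; exact: chart_cod_near.
move=> /nbhs_normP[r2 /= r20 rU].
(* Halving lets the ball of radius [r] around any [x] within [r] of [x0] stay inside both balls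
   around [u0]. *)
pose r := Num.min r1 r2 / 2.
have r0 : 0 < r by rewrite divr_gt0// lt_min r10.
have [rr1 rr2] : r + r <= r1 /\ r + r <= r2.
  by rewrite -splitr !ge_min !lexx orbT.
(* [F] bounds the norm of [X] at all such [x]; it may be 0, hence [F + 1] below. *)
pose F := b * (`|Y u0| + K * r).
have F0 : 0 <= F.
  by apply: mulr_ge0; [exact: ltW|rewrite addr_ge0// mulr_ge0// ltW].
have F1 : 0 < F + 1 by rewrite ltr_wpDl.
(* A curve of length below [2 * d * f] stays in the chart ball if [d < e1], changes [Y] by at most
   half of its initial norm if [d < e2], and has rescaled length below [eta] if [d < e3]. *)
pose e1 := a * r / (2 * (F + 1)).
pose e2 := a / (4 * K * b).
pose e3 := eta * a / (8 * b).
have [e10 e20 e30] : [/\ 0 < e1, 0 < e2 & 0 < e3].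
  have [h1 h2] : 0 < 2 * (F + 1) /\ 0 < 4 * K * b by rewrite !mulr_gt0.
  by split; apply: divr_gt0; rewrite // mulr_gt0.
exists ([set x | D i x /\ `|crd i x - u0| < r],
  [set d | [/\ 0 < d, d < e1, d < e2 & d < e3]]).
  split=> /=.
    apply: filterI; first exact: nbhs_dom.
    have : (fun q => `|crd i q - u0|) @ x0 --> `|u0 - u0|.
      apply: cvg_norm; apply: cvgB; last exact: cst_continuous.
      exact: Defs.coord_continuous.
    by move=> /(cvgr_lt _)/(_ r); rewrite subrr normr0; exact.
  near=> d; split; near: d;
    by [exact: nbhs_right_gt|exact: nbhs_right_lt].
move=> [x d] /= [[Dx xr] [d0 de1 de2 de3]] y Xx0 dxy.
set f := tnorm x (X x) in dxy.
have f0 : 0 < f by rewrite lt_def tnorm_eq0 Xx0 tnorm_ge0.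
(* The infimum need not be attained; as [f > 0], the factor 2 leaves room for an actual curve. *)
have : (dist x y < (2 * d * f)%:E)%E.
  by rewrite (le_lt_trans dxy)// lte_fin ltr_pM2r// ltr_pMl// ltr1n.
move=> /ereal_inf_lt[_ [c [pc c0 c1 _] <-] lc].
pose ux := crd i x.
have near_ux u : `|u - ux| < r -> `|u - u0| < r + r.
  move=> ur; rewrite -[u - u0](subrKA ux); apply: le_lt_trans (ler_normD _ _) _.
  exact: ltrD.
have ab_ux u : `|u - ux| < r -> chart_cod i u /\
    forall v, a * `|v| <= Num.sqrt (form i v v u) <= b * `|v|.
  move=> /near_ux ur; apply: rU; rewrite /ball_/= distrC.
  exact: lt_le_trans rr2.
have lip u : `|u - ux| < r -> `|Y u - Y ux| <= K * `|u - ux|.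
  move=> /near_ux ur; apply: lipY; first exact: lt_le_trans rr1.
  by apply: lt_le_trans rr1; rewrite (lt_trans xr)// ltrDl.
have uxx : `|ux - ux| < r by rewrite subrr normr0.
have fY : f <= b * `|Y ux|.
  rewrite /f (tnorm_field_in_chart X Dx).
  by have [_ /(_ (Y ux))/andP[]] := ab_ux _ uxx.
have fF : f <= F.
  apply: le_trans fY _; rewrite ler_pM2l// -lerBlDl.
  apply: le_trans (lerB_dist _ _) _.
  apply: le_trans (lipY _ _ _ _) _.
  - by apply: lt_le_trans rr1; rewrite (lt_trans xr)// ltrDl.
  - by rewrite subrr normr0.
  - by rewrite ler_pM2l// ltW.
have lar : (len c < (a * r)%:E)%E.
  apply: lt_trans lc _; rewrite lte_fin.
  have : d * (2 * (F + 1)) < a * r by rewrite -ltr_pdivlMr// mulr_gt0.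
  apply: le_lt_trans; nra.
have Dc0 : D i (c 0) by rewrite c0.
have g0 : form_ge_ball i a (crd i (c 0)) r.
  by rewrite c0 => u /ab_ux[Du Hu]; split=> // v; have /andP[] := Hu v.
have stay := curve_in_chart a0 r0 Dc0 g0 pc lar.
(* Along the curve the norm of [Y] is at least half that of [Y ux], itself at least [f / b]; the
   factor [a] returns to the Riemannian norm. *)
pose m := a / (2 * b) * f.
have m0 : 0 < m by rewrite mulr_gt0// divr_gt0// mulr_gt0.
have mX t : t \in `[0, 1] -> m <= tnorm (c t) (X (c t)).
  move=> /stay[Dt]; rewrite c0 -/ux => lt_; set ut := crd i (c t) in lt_.
  have ut_d : a * `|ut - ux| < 2 * d * f.
    by rewrite -lte_fin; exact: le_lt_trans lt_ lc.
  have ut_r : `|ut - ux| < r.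
    by rewrite -(ltr_pM2l a0) -lte_fin; exact: le_lt_trans lt_ lar.
  have Yut := lip _ ut_r.
  have [_ /(_ (Y ut))/andP[aY _]] := ab_ux _ ut_r.
  rewrite (tnorm_field_in_chart X Dt); apply: le_trans aY.
  have YY : `|Y ux| - `|Y ut| <= K * `|ut - ux|.
    by apply: le_trans (lerB_dist _ _) _; rewrite distrC.
  have dK : d * (4 * K * b) < a by rewrite -ltr_pdivlMr// !mulr_gt0.
  have KD : K * `|ut - ux| <= `|Y ux| / 2.
    rewrite -(ler_pM2l a0) mulrCA.
    apply: (@le_trans _ _ (K * (2 * d * (b * `|Y ux|)))).
      rewrite ler_pM2l// (le_trans (ltW ut_d))// ler_pM2l// mulr_gt0//.
    rewrite (_ : K * _ = d * (4 * K * b) * (`|Y ux| / 2)); last by field.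
    by rewrite ler_wpM2r ?divr_ge0// ltW.
  apply: (@le_trans _ _ (a * (`|Y ux| / 2))).
    rewrite (_ : m = a / 2 * (f / b)); last first.
      by rewrite /m invfM; ring.
    rewrite [leRHS](_ : _ = a / 2 * `|Y ux|); last by field.
    by rewrite ler_pM2l ?divr_gt0// ler_pdivrMr// mulrC.
  by rewrite ler_pM2l//; lra.
(* Fixed points are zeros of [X], so the lower bound [m] keeps the curve away from them. *)
have X0 t : t \in `[0, 1] -> ~ fix_set phi (c t).
  move=> /mX mt /(velocity_field_fix Xvel)/eqP; rewrite -(tnorm_eq0 (c t)).
  by rewrite gt_eqF// (lt_le_trans m0).
split; first by rewrite -c1; apply: X0; rewrite in_itv/= lexx ler01.
apply: (@le_lt_trans _ _ (curve_length (rescaled_metric X) c)).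
  by apply: ereal_inf_lbound; exists c.
apply: le_lt_trans (rescaled_length_le m0 pc mX) _.
apply: (@lt_trans _ _ ((m^-1)%:E * (2 * d * f)%:E)%E).
  by rewrite lte_pmul2l// lte_fin invr_gt0.
rewrite -EFinM lte_fin mulrC ltr_pdivrMr//.
have db : d * (8 * b) < eta * a by rewrite -ltr_pdivlMr// mulr_gt0.
rewrite /m mulrA ltr_pM2r// mulrA ltr_pdivlMr ?mulr_gt0//.
by apply: le_lt_trans db; have := mulr_gt0 d0 b0; lra.
Unshelve. all: by end_near. Qed.

End Rescaling.

(** * Uniform scale on the compact set and comparison of the two expansiveness notions *)

Theorem theorem3p20 (R : realType) (n : nat) (M : riemannian_manifold R n)
  (phi : R -> M -> M) (X : M -> 'rV[R]_n) (L : set M)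
  (phi_flow : is_flow phi)
  (X_velocity : velocity_field phi X)
  (X_C1 : C1_field X)
  (L_compact : compact L)
  (L_invariant : forall t : R, phi t @` L = L)
  (Mstar_connected : connected (~` fix_set phi))
  (X_invertible : forall s : M, fix_set phi s -> bijective (field_deriv X s))
  (L_expansive : BW_expansive (L `\` fix_set phi) (dist_r phi X) phi) :
  rescaling_expansive L phi X.
Proof.
have [_ phi0 phiD] := phi_flow.
have L_phi t x : L x -> L (phi t x).
  by move=> Lx; rewrite -(L_invariant t); exists x.
move=> e e0; have [eta eta0 expansive] := L_expansive e e0.
have /compact_near_coveringP cov := L_compact.
have [d [d0 short]] : exists d : R, 0 < d /\ forall x y, L x -> X x != 0 ->
    (dist x y <= (d * tnorm x (X x))%:E)%E ->
    ~ fix_set phi y /\ (dist_r phi X x y < eta%:E)%E.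
  have nshort := cov _ _ _ (at_right_proper_filter (0 : R))
    (fun x _ => short_curves_near x X_C1 X_velocity eta0).
  have [d [sd d0]] := filter_ex (filterI nshort (nbhs_right_gt (0 : R))).
  by exists d; split=> // x y Lx; exact: sd.
exists d => // x y h Lx Ly hh dxy.
have h0 : h 0 = 0 by have [_ _ _] := hh.
have eq_at t : X (phi t x) = 0 -> phi t x = phi (h t) y.
  move=> X0; apply: dist_eq.
  have /eqP T0 : tnorm (phi t x) (X (phi t x)) == 0 by rewrite tnorm_eq0 X0.
  by have := dxy t; rewrite T0 mulr0.
(* If [x] is fixed, [X] vanishes along its whole orbit, so the two orbits coincide at matching times
   and the time shift is 0. *)
have [fx|nfx] := pselect (fix_set phi x).
  move=> t; exists 0; first by rewrite /= in_itv/= oppr_le0 ltW.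
  by rewrite phi0; apply: eq_at; rewrite fx; exact: velocity_field_fix fx.
have nfix t : ~ fix_set phi (phi t x).
  move=> ft; apply: nfx => s.
  by have := ft (- t); rewrite -phiD addNr phi0 => E; rewrite {1}E ft -E.
apply: expansive => //.
(* That [y] is not fixed is read off at time 0, where [h 0 = 0]. *)
- split=> //.
  have [X0|X0] := eqVneq (X (phi 0 x)) 0.
    by have := nfix 0; rewrite (eq_at 0 X0) h0 phi0.
  by have [] := short _ _ (L_phi 0 x Lx) X0 (dxy 0); rewrite h0 phi0.
(* Where [X] vanishes the two points coincide, and the constant curve gives rescaled distance 0. *)
- move=> t; have [X0|X0] := eqVneq (X (phi t x)) 0.
    rewrite -(eq_at t X0).
    apply: le_lt_trans (_ : (0 < eta%:E)%E); last by rewrite lte_fin.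
    apply: dist_r_refl; exact: nfix.
  by have [] := short _ _ (L_phi t x Lx) X0 (dxy t).
Qed.
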